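(* Let $F$ be a field of characteristic $\ell\neq 2$, let $n\geq 1$, and suppose that $\ell\nmid 2n$. Let $W=\mathfrak{gl}(2n)$, $L=\mathfrak{sp}(2n)=L(J)$ and $M=M(J)$. Then the $L$-module $W$ has the following orthogonal decomposition (with respect to $\varphi$) into $L$-submodules: $$W=L\perp(M\cap\mathfrak{sl}(2n))\perp\mathfrak{s},$$ where $M=L^\perp$ and $$M=\left\{\begin{pmatrix}A&B\\ C&A'\end{pmatrix}\ \Big|\ A,B,C\in\mathfrak{gl}(n),\text{ where }B,C\text{ are skew-symmetric}\right\}.$$ Moreover, $M\cap\mathfrak{sl}(2n)$ is an $L$-module of dimension $2n^2-n-1$, which is faithful if $n\geq 2$. In particular, if every element of $F$ is a square and $n\geq 2$ then $M\cap\mathfrak{sl}(2n)$ induces an imbedding of Lie algebras $\mathfrak{sp}(2n)\hookrightarrow\mathfrak{so}(2n^2-n-1)$, which is an isomorphism $\mathfrak{sp}(4)\to\mathfrak{so}(5)$ when $n=2$.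
   Context: $\mathfrak{gl}(m)$ is the Lie algebra of $m\times m$ matrices over $F$ with $[x,y]=xy-yx$; $\mathfrak{sl}(m)$ its subspace of traceless matrices; $\mathfrak{s}$ its subspace of scalar matrices; $X'$ is the transpose of $X$. For $A\in\mathfrak{gl}(m)$, $L(A)=\{X\in\mathfrak{gl}(m)\mid X'A=-AX\}$ (a Lie subalgebra) and $M(A)=\{Y\in\mathfrak{gl}(m)\mid Y'A=AY\}$. $J=\begin{pmatrix}0&I_n\\-I_n&0\end{pmatrix}\in\mathfrak{gl}(2n)$, $\mathfrak{sp}(2n)=L(J)$, and $\mathfrak{so}(m)=L(I_m)$ is the Lie algebra of skew-symmetric $m\times m$ matrices. $W$ is an $L$-module via $x\cdot w=[x,w]$. $\varphi:W\times W\to F$ is the non-degenerate symmetric bilinear form $\varphi(x,y)=\mathrm{tr}(xy)$; $\perp$ refers to $\varphi$. An $L$-module is faithful if the associated representation is injective. If $U$ is a faithful $L$-module of dimension $d$ carrying an $L$-invariant non-degenerate symmetric bilinear form $\phi$ (invariant: $\phi(x\cdot u,v)+\phi(u,x\cdot v)=0$), and every element of $F$ is a square, then choosing an orthonormal basis of $U$ the representation becomes an imbedding $L\hookrightarrow\mathfrak{so}(d)$; this is the meaning of ''induces an imbedding'' (here with the restriction of $\varphi$). *)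

(* Defs.v *)
From HB Require Import structures.
From mathcomp Require Import all_boot all_order all_algebra.

Set Implicit Arguments.
Unset Strict Implicit.
Unset Printing Implicit Defensive.

Import GRing.Theory.
Local Open Scope ring_scope.

Definition bracket (F : fieldType) m (x y : 'M[F]_m) : 'M[F]_m := x *m y - y *m x.

Section Defects.
Variables (F : fieldType) (m : nat) (A : 'M[F]_m).

Definition skew_defect (X : 'M[F]_m) : 'M[F]_m := X^T *m A + A *m X.
Definition self_defect (Y : 'M[F]_m) : 'M[F]_m := Y^T *m A - A *m Y.

Fact skew_defect_is_linear : linear skew_defect.
Proof.
move=> a X Y; rewrite /skew_defect linearP /= mulmxDl mulmxDr.
by rewrite -scalemxAl -scalemxAr addrACA -scalerDr.
Qed.

Fact self_defect_is_linear : linear self_defect.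
Proof.
move=> a X Y; rewrite /self_defect linearP /= mulmxDl mulmxDr.
by rewrite -scalemxAl -scalemxAr opprD addrACA -scalerBr.
Qed.

End Defects.

HB.instance Definition _ (F : fieldType) m (A : 'M[F]_m) :=
  GRing.isLinear.Build F 'M[F]_m 'M[F]_m _ (skew_defect A) (skew_defect_is_linear A).
HB.instance Definition _ (F : fieldType) m (A : 'M[F]_m) :=
  GRing.isLinear.Build F 'M[F]_m 'M[F]_m _ (self_defect A) (self_defect_is_linear A).

Section Subspaces.
Variables (F : fieldType) (m : nat) (A : 'M[F]_m).

Definition lieL : {vspace 'M[F]_m} := lker (linfun (skew_defect A)).
Definition lieM : {vspace 'M[F]_m} := lker (linfun (self_defect A)).

Lemma mem_lieL X : (X \in lieL) = (X^T *m A == - (A *m X)).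
Proof. by rewrite memv_ker lfunE /= addr_eq0. Qed.

Lemma mem_lieM Y : (Y \in lieM) = (Y^T *m A == A *m Y).
Proof. by rewrite memv_ker lfunE /= subr_eq0. Qed.

Lemma lieL_subalgebra : {in lieL &, forall X Y, bracket X Y \in lieL}.
Proof.
move=> X Y; rewrite !mem_lieL => /eqP hX /eqP hY; apply/eqP.
rewrite /bracket linearB /= !trmx_mul mulmxBl mulmxBr -!mulmxA hX hY.
by rewrite !mulmxN !mulmxA hX hY !mulNmx !opprK -!mulmxA opprB.
Qed.

End Subspaces.

Definition sl (F : fieldType) m : {vspace 'M[F]_m} := lker (linfun (mxtrace : 'M[F]_m -> F^o)).

Lemma mem_sl (F : fieldType) m (X : 'M[F]_m) : (X \in sl F m) = (\tr X == 0).
Proof. by rewrite memv_ker lfunE. Qed.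

Definition scalars (F : fieldType) m : {vspace 'M[F]_m} := <[1%:M]>%VS.

Lemma mem_scalars (F : fieldType) m (X : 'M[F]_m) : (X \in scalars F m) = is_scalar_mx X.
Proof.
apply/vlineP/is_scalar_mxP => -[a ->]; exists a; first by rewrite scalemx1.
by rewrite scalemx1.
Qed.

Definition Jmx (F : fieldType) n : 'M[F]_(n + n) := block_mx 0 1%:M (- 1%:M) 0.

Definition sp (F : fieldType) n : {vspace 'M[F]_(n + n)} := lieL (Jmx F n).
Definition so (F : fieldType) m : {vspace 'M[F]_m} := lieL 1%:M.

Definition trform (F : fieldType) m (x y : 'M[F]_m) : F := \tr (x *m y).

Fact trform_is_bilinear (F : fieldType) m :
  bilinear_for *%R (idfun \; *%R) (@trform F m : 'M[F]_m -> 'M[F]_m -> F).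
Proof.
split=> u a x y; rewrite /applyr_head /trform /=.
  by rewrite mulmxDl -scalemxAl linearP.
by rewrite mulmxDr -scalemxAr linearP.
Qed.
HB.instance Definition _ (F : fieldType) m := bilinear_isBilinear.Build F 'M[F]_m 'M[F]_m F
  *%R (idfun \; *%R) (@trform F m) (trform_is_bilinear F m).

Fact trform_is_symmetric (F : fieldType) m (x y : 'M[F]_m) :
  trform x y = (-1) ^+ false * idfun (trform y x).
Proof. by rewrite mul1r /trform mxtrace_mulC. Qed.
HB.instance Definition _ (F : fieldType) m := isHermitianSesquilinear.Build F 'M[F]_m
  false idfun (@trform F m) (@trform_is_symmetric F m).

Definition trace_form (F : fieldType) m : {symmetric 'M[F]_m} := @trform F m.

(* In what follows L is a Lie subalgebra of gl(m), acting on gl(m) and on its *)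
(* subspaces by bracket.                                                      *)
Section Modules.
Variables (F : fieldType) (m : nat) (L U : {vspace 'M[F]_m}).

Definition submodule := {in L & U, forall x u, bracket x u \in U}.

Definition faithful :=
  {in L &, forall x y, {in U, bracket x =1 bracket y} -> x = y}.

Definition trace_form_invariant := {in L & U &, forall x u v,
  trace_form F m (bracket x u) v + trace_form F m u (bracket x v) = 0}.

Definition trace_form_nondegenerate := (U :&: orthov (trace_form F m) U = 0)%VS.

Definition orthonormal_basis d (b : d.-tuple 'M[F]_m) :=
  basis_of U b && orthonormal (trace_form F m) b.

(* The j-th column holds the coordinates of x . b_j, so that products of     *)
(* matrices correspond to composites of endomorphisms, in the same order.    *)
Definition ad_mx d (b : d.-tuple 'M[F]_m) (x : 'M[F]_m) : 'M[F]_d :=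
  \matrix_(i, j) coord b i (bracket x b`_j).

Definition lie_embedding d (K : {vspace 'M[F]_d}) (f : 'M[F]_m -> 'M[F]_d) :=
  [/\ {in L, forall x, f x \in K},
      forall a, {in L &, forall x y, f (a *: x + y) = a *: f x + f y},
      {in L &, {morph f : x y / bracket x y}}
    & {in L &, injective f}].

Definition lie_isomorphism d (K : {vspace 'M[F]_d}) (f : 'M[F]_m -> 'M[F]_d) :=
  lie_embedding K f /\ {in K, forall y, exists2 x, x \in L & f x = y}.

Definition orthogonal_module d :=
  [/\ [/\ submodule, faithful & \dim U = d],
      trace_form_invariant, trace_form_nondegenerate
    & exists b : d.-tuple 'M[F]_m, orthonormal_basis b].

Definition induces_embedding d := orthogonal_module d /\
  forall b : d.-tuple 'M[F]_m, orthonormal_basis b ->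
    lie_embedding (so F d) (ad_mx b).

Definition induces_isomorphism d := orthogonal_module d /\
  forall b : d.-tuple 'M[F]_m, orthonormal_basis b ->
    lie_isomorphism (so F d) (ad_mx b).

End Modules.

(* Main.v *)
(* The bracket with an element of L = sp(2n) preserves M, and L and M are the *)
(* -1 and +1 eigenspaces of the involution X |-> J^-1 X^T J, which are        *)
(* orthogonal for the trace form because tr(XY) = - tr(XY) on L x M. Hence    *)
(* gl(2n) = L + M orthogonally; the scalars split off M since 2n is           *)
(* invertible. Left multiplication by J identifies M with so(2n), which gives *)
(* all the dimensions. If n >= 2, a matrix of L commuting with M is 0: block  *)
(* by block, it has to commute with diag(Z, Z^T) for all Z and with one       *)
(* nonzero skew upper right block. Gram-Schmidt, available once every element *)
(* is a square, gives an orthonormal basis, in which invariance of the form   *)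
(* makes the action skew-symmetric. For n = 2 both algebras have dimension 10. *)
Require Import Defs.
From HB Require Import structures.
From mathcomp Require Import all_boot all_order all_algebra ring zify.
Import GRing.Theory.
Local Open Scope ring_scope.

Set Implicit Arguments.
Unset Strict Implicit.
Unset Printing Implicit Defensive.

(** For [A] invertible and skew, and 2 invertible, X |-> A^-1 X^T A is an involutive,
    trace-preserving anti-automorphism with eigenspaces [lieL A] and [lieM A]. These are therefore
    complementary ([addv_lieL_lieM], [capv_lieL_lieM]) and orthogonal ([lieL_orthov_lieM]). As the
    trace form is nondegenerate on all matrices, [orthov_complement] turns this into M = L^perp, and
    [capv_orthov_eq0] makes every summand nondegenerate, in particular M0, the traceless part of M.

    The embedding is a general fact about a faithful submodule with an orthonormal basis
    ([ad_mx_lie_embedding]): the action in coordinates respects brackets by the Jacobi identity, is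
    skew by invariance and injective by faithfulness. Here [exists_orthonormal_basis] supplies the
    basis and [sp_centralizer_lieM] the faithfulness. For n = 2 source and target both have
    dimension 'C(5, 2), so injectivity forces surjectivity. *)

(** * Orthonormal bases for nondegenerate symmetric forms *)

Section OrthonormalBasis.
Variables (F : fieldType) (vT : vectType F) (form : {symmetric vT}).
Implicit Types (U : {vspace vT}) (s : seq vT).

Lemma symm_formC u v : form u v = form v u.
Proof. by rewrite hermC mul1r. Qed.

Lemma orthonormal_form_nth s i j : orthonormal form s ->
  (i < size s)%N -> (j < size s)%N -> form s`_i s`_j = (i == j)%:R.
Proof.
elim: s i j => [|v s IHs] //= i j /andP[/= /andP[/eqP vv s1]].
rewrite andbT => /andP[/allP v_s s_s].
have ons : orthonormal form s by apply/andP.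
case: i j => [|i] [|j] //= lt_i lt_j; last exact: IHs.
  by apply/eqP/v_s/mem_nth.
by rewrite symm_formC; apply/eqP/v_s/mem_nth.
Qed.

Lemma coord_orthonormal U d (b : d.-tuple vT) i v :
  basis_of U b -> orthonormal form b -> v \in U -> coord b i v = form v b`_i.
Proof.
move=> basU onb Uv; rewrite [in RHS](coord_basis basU Uv) linear_sumlz.
rewrite (bigD1 i) //= linearZl_LR /= orthonormal_form_nth ?size_tuple ?ltn_ord // eqxx mulr1.
rewrite big1 ?addr0 // => j /negPf ne_ji.
by rewrite linearZl_LR /= orthonormal_form_nth ?size_tuple ?ltn_ord // val_eqE ne_ji mulr0.
Qed.

Hypothesis nz2 : 2%:R != 0 :> F.

(* If u and v are isotropic, then form (u + v) (u + v) = 2 * form u v.       *)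
Lemma nonisotropic_vector U : ~~ (U <= orthov form U)%VS ->
  exists2 u, u \in U & form u u != 0.
Proof.
case/subvPn=> u Uu /mem_orthovPn[v Uv uv].
have [uu|] := eqVneq (form u u) 0; last by exists u.
have [vv|] := eqVneq (form v v) 0; last by exists v.
exists (u + v); first exact: rpredD.
rewrite linearDl /= !linearDr /= uu vv add0r addr0 (symm_formC v u).
by rewrite -mulr2n -mulr_natl mulf_neq0.
Qed.

(** Gram-Schmidt by induction on the dimension: a nonisotropic vector is scaled to norm 1 by a
    square root of its norm, and the induction continues in its complement inside [U], which is
    again nondegenerate. *)
Lemma exists_orthonormal_basis U d :
  (forall a : F, exists c, a = c ^+ 2) ->
  (U :&: orthov form U = 0)%VS -> \dim U = d ->
  exists b : d.-tuple vT, basis_of U b && orthonormal form b.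
Proof.
move=> squares; elim: d U => [|d IHd] U ndU dimU.
  exists [tuple]; rewrite andbT; move/eqP: dimU; rewrite dimv_eq0 => /eqP->.
  exact: nil_basis.
have /nonisotropic_vector[u Uu uu] : ~~ (U <= orthov form U)%VS.
  by apply/negP => /capv_idPl; rewrite ndU => U0; rewrite -U0 dimv0 in dimU.
have [c def_c] := squares (form u u).
have nz_c : c != 0 by apply: contraNneq uu => c0; rewrite def_c c0 expr0n.
pose e := c^-1 *: u.
have Ue : e \in U by rewrite rpredZ.
have ee : form e e = 1.
  by rewrite /e linearZl_LR linearZr_LR /= def_c expr2 mulKf // mulVf.
have eNU : e \notin orthov form U.
  by apply/mem_orthovPn; exists e; rewrite ?ee ?oner_eq0.
pose U' := (U :&: orthov form <[e]>)%VS.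
have dimU' : \dim U' = d by rewrite -(eq_dim_orthov1 eNU) dimU.
have projU' x : x \in U -> x - form x e *: e \in U'.
  move=> Ux; rewrite memv_cap rpredB ?rpredZ //= mem_orthov1.
  by rewrite linearBl /= linearZl_LR /= ee mulr1 subrr.
(* A vector of U' orthogonal to U' is also orthogonal to [e], hence by [projU'] to all of [U]. *)
have ndU' : (U' :&: orthov form U' = 0)%VS.
  apply/eqP; rewrite -subv0 -ndU; apply/subvP => w.
  rewrite !memv_cap => /andP[/andP[-> we] /mem_orthovP wU'] /=.
  apply/mem_orthovP => x Ux; have := wU' _ (projU' x Ux).
  move: we; rewrite mem_orthov1 => /eqP we.
  by rewrite linearBr linearZr_LR /= we mulr0 subr0.
have [b /andP[basb onb]] := IHd U' ndU' dimU'.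
exists [tuple of e :: b]; apply/andP; split.
  rewrite basisEdim /= size_tuple dimU leqnn andbT; apply/subvP => x Ux.
  rewrite span_cons (span_basis basb) -[x](subrK (form x e *: e)) addrC.
  by rewrite memv_add ?projU' // rpredZ ?memv_line.
case/andP: onb => b1 bb; rewrite /orthonormal /= ee eqxx b1 bb !andbT /=.
apply/allP => v /(basis_mem basb); rewrite memv_cap mem_orthov1 => /andP[_].
by rewrite /= symm_formC.
Qed.

End OrthonormalBasis.

(** * Skew matrices, centralizers, brackets and the trace form *)

Section Matrices.
Variable F : fieldType.

Lemma mem_so m (X : 'M[F]_m) : (X \in so F m) = (X^T == - X).
Proof. by rewrite mem_lieL mulmx1 mul1mx. Qed.

(** Induction by bordering: the corner of a skew matrix vanishes since 2 is invertible, its first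
    column is determined by its first row, and the remaining row [f] and block [g] are free. The
    dimension thus grows by [m], which is Pascal's rule. *)
Lemma dim_so m : 2%:R != 0 :> F -> \dim (so F m) = 'C(m, 2).
Proof.
move=> nz2; elim: m => [|m IHm].
  by apply/eqP; rewrite -leqn0 (leq_trans (dimvS (subvf _))) // dimvf dim_matrix.
pose f : 'Hom('M[F]_(1 + m), 'rV[F]_m) := linfun (rsubmx \o usubmx).
pose g : 'Hom('M[F]_(1 + m), 'M[F]_m) := linfun (rsubmx \o dsubmx).
have fE X : f X = ursubmx X by rewrite lfunE.
have gE X : g X = drsubmx X by rewrite lfunE.
have skew_block (v : 'rV[F]_m) Z : Z \in so F m ->
  (block_mx 0 v (- v^T) Z : 'M_(1 + m)) \in so F (1 + m).
  rewrite !mem_so => /eqP Z_skew.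
  by rewrite tr_block_mx opp_block_mx Z_skew !trmx0 raddfN /= trmxK oppr0 opprK.
have ul0 (X : 'M[F]_(1 + m)) : X \in so F (1 + m) -> ulsubmx X = 0.
  rewrite mem_so => /eqP skX; apply/matrixP => i j; rewrite !ord1 !mxE.
  have := congr1 (fun Y : 'M_(1 + m) => Y (lshift m 0) (lshift m 0)) skX.
  rewrite !mxE => /eqP; rewrite -addr_eq0 -mulr2n -mulr_natl mulf_eq0 (negPf nz2).
  by move/eqP.
have dl (X : 'M[F]_(1 + m)) : X \in so F (1 + m) -> dlsubmx X = - (ursubmx X)^T.
  by rewrite mem_so => /eqP skX; rewrite trmx_ursub skX; apply/matrixP => i j; rewrite !mxE opprK.
have f_so : (f @: so F (1 + m) = fullv)%VS.
  apply/eqP; rewrite eqEsubv subvf; apply/subvP => v _; apply/memv_imgP.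
  by exists (block_mx 0 v (- v^T) 0); rewrite ?skew_block ?mem0v // fE block_mxKur.
have g_ker : \dim (so F (1 + m) :&: lker f) = \dim (so F m).
  rewrite -(@limg_dim_eq _ _ _ g).
    congr (\dim _); apply/eqP; rewrite eqEsubv; apply/andP; split; apply/subvP => Z.
      case/memv_imgP => X; rewrite memv_cap mem_so => /andP[/eqP skX _] ->.
      by rewrite gE mem_so trmx_drsub skX; apply/eqP/matrixP => i j; rewrite !mxE.
    move=> soZ; apply/memv_imgP; exists (block_mx 0 0 (- 0^T) Z).
      by rewrite memv_cap skew_block // (memv_ker f) fE block_mxKur eqxx.
    by rewrite gE block_mxKdr.
  apply/eqP; rewrite -subv0; apply/subvP => X; rewrite !memv_cap (memv_ker f) (memv_ker g) fE gE.
  case/andP=> /andP[soX /eqP ur0] /eqP dr0.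
  by rewrite memv0 -[X]submxK (ul0 _ soX) (dl _ soX) ur0 dr0 trmx0 oppr0 block_mx0.
rewrite -[m.+1]/(1 + m)%N -(limg_ker_dim f) f_so g_ker IHm dimvf dim_matrix mul1r.
by rewrite binS bin1.
Qed.

Lemma mulmx_delta_entry m (A : 'M[F]_m) (i j k l : 'I_m) :
  (A *m delta_mx i j) k l = A k i *+ (l == j).
Proof.
rewrite mxE (bigD1 i) //= mxE eqxx /= mulr_natr big1 ?addr0 // => i' /negPf ne.
by rewrite mxE ne mulr0.
Qed.

Lemma delta_mulmx_entry m (A : 'M[F]_m) (i j k l : 'I_m) :
  (delta_mx i j *m A) k l = A j l *+ (k == i).
Proof.
rewrite mxE (bigD1 j) //= mxE eqxx andbT mulr_natl big1 ?addr0 // => j' /negPf ne.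
by rewrite mxE ne andbF mul0r.
Qed.

Lemma centralizer_is_scalar m (A : 'M[F]_m) :
  (forall X, A *m X = X *m A) -> is_scalar_mx A.
Proof.
case: m A => [|m] A comm_A; first by rewrite [A]flatmx0 mx0_is_scalar.
apply/is_scalar_mxP; exists (A 0 0); apply/matrixP => i j.
(* This entry reads A i j = A 0 0 if i = j, and A i j = 0 otherwise. *)
have := congr1 (fun X : 'M_m.+1 => X i 0) (comm_A (delta_mx j 0)).
by rewrite mulmx_delta_entry delta_mulmx_entry mxE.
Qed.

(** The off-diagonal blocks of a matrix commuting with every diag(Z, Z^T) satisfy this relation.
    Testing it on the elementary matrix at (p, q) with p != i isolates A i q; the bound on [m]
    provides such a [p]. *)
Lemma twisted_centralizer_eq0 m (A : 'M[F]_m) : (2 <= m)%N ->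
  (forall X, A *m X^T = X *m A) -> A = 0.
Proof.
move=> m_ge2 comm_A; apply/matrixP => i q; rewrite mxE.
have [p ne_pi] : exists p : 'I_m, p != i.
  have [->|i_neq0] := eqVneq i (Ordinal (ltnW m_ge2)); first by exists (Ordinal m_ge2).
  by exists (Ordinal (ltnW m_ge2)); rewrite eq_sym.
have := congr1 (fun X : 'M_m => X i p) (comm_A (delta_mx p q)).
by rewrite trmx_delta mulmx_delta_entry delta_mulmx_entry eqxx eq_sym (negPf ne_pi).
Qed.

Lemma exists_skew_neq0 m : (2 <= m)%N -> exists2 B : 'M[F]_m, B^T = - B & B != 0.
Proof.
move=> m_ge2; pose i := Ordinal (ltnW m_ge2); pose j := Ordinal m_ge2.
exists (delta_mx i j - delta_mx j i); first by rewrite raddfB /= !trmx_delta opprB.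
apply/eqP => /matrixP/(_ i j); rewrite !mxE !eqxx /= subr0 => /eqP.
by rewrite oner_eq0.
Qed.

Lemma bracketBl m (X Y Z : 'M[F]_m) :
  bracket (X - Y) Z = bracket X Z - bracket Y Z.
Proof. by rewrite /bracket mulmxBl mulmxBr !opprD !opprK addrACA. Qed.

Lemma bracket_linearl m a (X Y Z : 'M[F]_m) :
  bracket (a *: X + Y) Z = a *: bracket X Z + bracket Y Z.
Proof.
rewrite /bracket mulmxDl mulmxDr -scalemxAl -scalemxAr scalerBr opprD.
by rewrite addrACA.
Qed.

Lemma bracket_linearr m a (X Y Z : 'M[F]_m) :
  bracket X (a *: Y + Z) = a *: bracket X Y + bracket X Z.
Proof.
rewrite /bracket mulmxDl mulmxDr -scalemxAl -scalemxAr scalerBr opprD.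
by rewrite addrACA.
Qed.

HB.instance Definition _ m (X : 'M[F]_m) :=
  GRing.isLinear.Build F 'M[F]_m 'M[F]_m _ (bracket X) (fun a Y Z => bracket_linearr a X Y Z).

Lemma bracket_jacobi m (X Y Z : 'M[F]_m) :
  bracket (bracket X Y) Z = bracket X (bracket Y Z) - bracket Y (bracket X Z).
Proof.
rewrite /bracket !mulmxBl !mulmxBr !mulmxA !opprB.
set xyz := X *m Y *m Z; set yxz := Y *m X *m Z.
set zxy := Z *m X *m Y; set zyx := Z *m Y *m X.
set xzy := X *m Z *m Y; set yzx := Y *m Z *m X.
apply/matrixP => i j; rewrite !mxE; ring.
Qed.

Lemma mxtrace_bracket m (X Y : 'M[F]_m) : \tr (bracket X Y) = 0.
Proof. by rewrite /bracket raddfB /= mxtrace_mulC subrr. Qed.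

Lemma bracket_scalar m (X : 'M[F]_m) a : bracket X a%:M = 0.
Proof. by rewrite /bracket scalar_mxC subrr. Qed.

(** Bracketing with [X] is a derivation, so the sum is the trace of the commutator of [X] with U
    V. *)
Lemma trace_form_bracket m (X U V : 'M[F]_m) :
  trace_form F m (bracket X U) V + trace_form F m U (bracket X V) = 0.
Proof.
rewrite /= /trform /bracket mulmxBl mulmxBr !raddfB /= !mulmxA.
by rewrite addrA subrK -[X *m U *m V]mulmxA mxtrace_mulC subrr.
Qed.

(** Pairing [X] with the elementary matrix at (j, i) returns the entry X i j. *)
Lemma orthov_trace_form_fullv m : orthov (trace_form F m) fullv = 0%VS.
Proof.
apply/eqP; rewrite -subv0; apply/subvP => X /mem_orthovP X_perp; rewrite memv0.
apply/eqP/matrixP => i j; rewrite mxE -(X_perp (delta_mx j i)) ?memvf //=.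
rewrite /trform /mxtrace (bigD1 i) //= mulmx_delta_entry eqxx big1 ?addr0 //.
by move=> k /negPf ne; rewrite mulmx_delta_entry ne.
Qed.

End Matrices.

(** * The splitting of gl(m) defined by an invertible skew matrix *)

Section SkewAndSelfAdjoint.
Variables (F : fieldType) (m : nat) (A : 'M[F]_m).
Implicit Types X Y : 'M[F]_m.

Lemma bracket_lieL_lieM : {in lieL A & lieM A, forall X Y, bracket X Y \in lieM A}.
Proof.
move=> X Y; rewrite mem_lieL !mem_lieM => /eqP hX /eqP hY; apply/eqP.
rewrite /bracket raddfB /= !trmx_mul mulmxBl mulmxBr -!mulmxA hX hY.
by rewrite mulmxN !mulmxA hX hY mulNmx opprK addrC.
Qed.

Hypotheses (nz2 : 2%:R != 0 :> F) (unitA : A \in unitmx).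

Lemma eq_opp_mx_eq0 p q (X : 'M[F]_(p, q)) : X = - X -> X = 0.
Proof.
move/eqP; rewrite -addr_eq0 -mulr2n -scaler_nat scaler_eq0 (negPf nz2).
by move/eqP.
Qed.

Lemma capv_lieL_lieM : (lieL A :&: lieM A = 0)%VS.
Proof.
apply/eqP; rewrite -subv0; apply/subvP => X; rewrite memv_cap mem_lieL mem_lieM memv0.
case/andP=> /eqP-> /eqP/esym/eq_opp_mx_eq0 AX0.
by rewrite -(mulKmx unitA X) AX0 mulmx0.
Qed.

(** From X = - A^-1 X^T A and A Y = Y^T A one gets X Y = - A^-1 (Y X)^T A; conjugation and
    transposition preserve the trace, so tr(X Y) is its own opposite. *)
Lemma lieL_orthov_lieM : (lieL A <= orthov (trace_form F m) (lieM A))%VS.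
Proof.
apply/orthovP => X Y; rewrite mem_lieL mem_lieM => /eqP hX /eqP hY /=.
have : \tr (X *m Y) = - \tr (X *m Y).
  rewrite -[in LHS](mulKmx unitA X) -mulmxA -[A *m X]opprK -hX mulNmx mulmxN.
  rewrite -[X^T *m A *m Y]mulmxA -hY raddfN /= mxtrace_mulC !mulmxA mulmxK //.
  by rewrite -trmx_mul mxtrace_tr mxtrace_mulC.
move/eqP; rewrite -addr_eq0 -mulr2n -mulr_natl mulf_eq0 (negPf nz2).
by move/eqP.
Qed.

Hypothesis skewA : A^T = - A.

(* The two summands are the eigenspaces of the involution X |-> A^-1 X^T A.  *)
Lemma addv_lieL_lieM : (lieL A + lieM A = fullv)%VS.
Proof.
apply/eqP; rewrite eqEsubv subvf; apply/subvP => X _.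
pose Z := invmx A *m X^T *m A.
have AZ : A *m Z = X^T *m A by rewrite /Z -mulmxA mulKVmx.
(* Skewness of [A] makes the map an involution: it sends [Z] back to [X]. *)
have ZA : Z^T *m A = A *m X.
  have AV : (invmx A)^T *m A = - 1%:M.
    by rewrite -[A in _ *m A]opprK -skewA mulmxN -trmx_mul mulmxV ?trmx1.
  by rewrite /Z !trmx_mul trmxK skewA -!mulmxA AV !mulmxN mulmx1 mulNmx opprK.
have LXZ : X - Z \in lieL A.
  by rewrite mem_lieL raddfB /= mulmxBl mulmxBr ZA AZ opprB.
have MXZ : X + Z \in lieM A.
  by rewrite mem_lieM raddfD /= mulmxDl mulmxDr ZA AZ addrC.
have -> : X = 2%:R^-1 *: (X - Z) + 2%:R^-1 *: (X + Z).
  rewrite -scalerDr addrACA addNr addr0 -mulr2n -scaler_nat scalerA mulVf //.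
  by rewrite scale1r.
apply: (memv_add (memvZ _ LXZ) (memvZ _ MXZ)).
Qed.

(** As [A] is skew, A X is skew exactly when X^T A = A X, so left multiplication by [A] carries
    [lieM A] isomorphically onto [so F m]. *)
Lemma dim_lieM : \dim (lieM A) = 'C(m, 2).
Proof.
rewrite -(dim_so m nz2); pose f : 'End('M[F]_m) := linfun (mulmx A).
have fE X : f X = A *m X by rewrite lfunE.
rewrite -(@limg_dim_eq _ _ _ f); last first.
  apply/eqP; rewrite -subv0; apply/subvP => X; rewrite memv_cap (memv_ker f) fE memv0.
  by case/andP=> _ /eqP AX0; rewrite -(mulKmx unitA X) AX0 mulmx0.
congr (\dim _); apply/eqP; rewrite eqEsubv; apply/andP; split; apply/subvP => Z.
  case/memv_imgP=> X; rewrite mem_lieM => /eqP hX ->.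
  by rewrite fE mem_so trmx_mul skewA mulmxN hX.
have AE : A = - A^T by rewrite skewA opprK.
rewrite mem_so => /eqP skewZ; apply/memv_imgP; exists (invmx A *m Z).
  rewrite mem_lieM mulKVmx // trmx_mul skewZ [X in _ *m X]AE.
  by rewrite !mulNmx mulmxN opprK -mulmxA -trmx_mul mulmxV ?trmx1 ?mulmx1.
by rewrite fE mulKVmx.
Qed.

End SkewAndSelfAdjoint.

(** * The representation of L on U in coordinates *)

Section Embedding.
Variables (F : fieldType) (m d : nat) (L U : {vspace 'M[F]_m}).
Variable b : d.-tuple 'M[F]_m.
Hypotheses (LU : submodule L U) (basU : basis_of U b).

Let b_mem (i : 'I_d) : b`_i \in U.
Proof. by apply: (basis_mem basU); rewrite mem_nth // size_tuple. Qed.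

Lemma ad_mx_linear a x y : ad_mx b (a *: x + y) = a *: ad_mx b x + ad_mx b y.
Proof. by apply/matrixP => i j; rewrite !mxE bracket_linearl linearP. Qed.

HB.instance Definition _ :=
  GRing.isLinear.Build F 'M[F]_m 'M[F]_d _ (ad_mx b) ad_mx_linear.

Lemma ad_mxE x (j : 'I_d) : x \in L -> bracket x b`_j = \sum_i ad_mx b x i j *: b`_i.
Proof.
move=> Lx; rewrite [LHS](coord_basis basU (LU Lx (b_mem j))).
by apply: eq_bigr => i _; rewrite mxE.
Qed.

Lemma ad_mx_mul x y : x \in L -> y \in L -> forall i j : 'I_d,
  coord b i (bracket x (bracket y b`_j)) = (ad_mx b x *m ad_mx b y) i j.
Proof.
move=> Lx Ly i j; rewrite ad_mxE // !linear_sum mxE; apply: eq_bigr => k _.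
by rewrite !linearZ /= [ad_mx b x i k]mxE mulrC.
Qed.

Lemma ad_mx_bracket : {in L &, {morph ad_mx b : x y / bracket x y}}.
Proof.
move=> x y Lx Ly; apply/matrixP => i j.
by rewrite mxE bracket_jacobi linearB /= !ad_mx_mul // /bracket !mxE.
Qed.

Lemma ad_mx_inj : faithful L U -> {in L &, injective (ad_mx b)}.
Proof.
move=> faithU x y Lx Ly eq_xy; apply: faithU => // u Uu.
rewrite (coord_basis basU Uu) !linear_sum; apply: eq_bigr => j _.
by rewrite !linearZ /= !ad_mxE // eq_xy.
Qed.

(** In an orthonormal basis the (i, j) entry is the form of [x, b_j] with b_i, so invariance of the
    form is skew-symmetry of the matrix. *)
Lemma ad_mx_so x : orthonormal (trace_form F m) b -> x \in L -> ad_mx b x \in so F d.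
Proof.
move=> onb Lx; rewrite mem_so; apply/eqP/matrixP => i j; rewrite !mxE.
rewrite !(coord_orthonormal _ basU onb) ?LU // [X in - X]symm_formC.
by apply/eqP; rewrite -addr_eq0 trace_form_bracket.
Qed.

Lemma ad_mx_lie_embedding : faithful L U -> orthonormal (trace_form F m) b ->
  lie_embedding L (so F d) (ad_mx b).
Proof.
move=> faithU onb; split.
- by move=> x; apply: ad_mx_so.
- by move=> a x y _ _; apply: ad_mx_linear.
- exact: ad_mx_bracket.
- exact: ad_mx_inj.
Qed.

Lemma ad_mx_lie_isomorphism : faithful L U -> orthonormal (trace_form F m) b ->
  \dim L = \dim (so F d) -> lie_isomorphism L (so F d) (ad_mx b).
Proof.
move=> faithU onb dimL; split; first exact: ad_mx_lie_embedding.
pose f : 'Hom('M[F]_m, 'M[F]_d) := linfun (ad_mx b).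
have fE x : f x = ad_mx b x by rewrite lfunE.
suff <- : (f @: L = so F d)%VS by move=> y /memv_imgP[x Lx ->]; exists x; rewrite ?fE.
apply/eqP; rewrite eqEdim -dimL limg_dim_eq ?leqnn ?andbT.
  by apply/subvP => y /memv_imgP[x Lx ->]; rewrite fE ad_mx_so.
apply/eqP; rewrite -subv0; apply/subvP => x; rewrite memv_cap (memv_ker f) fE memv0.
case/andP=> Lx /eqP x0; apply/eqP/ad_mx_inj; rewrite ?mem0v //.
by rewrite x0 linear0.
Qed.

End Embedding.

(** * Orthogonal summands of a nondegenerate space *)

Section OrthogonalComplement.
Variables (F : fieldType) (vT : vectType F) (form : {symmetric vT}).
Variables U V : {vspace vT}.
Hypotheses (nd : orthov form fullv = 0%VS).
Hypotheses (UV_full : (U + V)%VS = fullv) (UV : (U <= orthov form V)%VS).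

(** A vector of [U] is orthogonal to [V] anyway; if it is also orthogonal to [U], it is orthogonal
    to the whole space. *)
Lemma capv_orthov_eq0 : (U :&: orthov form U = 0)%VS.
Proof.
apply/eqP; rewrite -subv0 -nd -UV_full; apply/subvP => u.
rewrite memv_cap => /andP[Uu /mem_orthovP uU]; apply/mem_orthovP => w.
case/memv_addP=> u' Uu' [v Vv ->].
by move/orthovP: UV => UV0; rewrite linearDr /= uU // add0r UV0.
Qed.

Lemma orthov_complement : orthov form U = V.
Proof.
apply/eqP; rewrite eqEsubv [X in _ && X]orthov_sym UV andbT.
apply/subvP => w w_perp; have : w \in (U + V)%VS by rewrite UV_full memvf.
case/memv_addP=> u Uu [v Vv def_w].
have u_perp : u \in orthov form U.
  have -> : u = w - v by rewrite def_w addrK.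
  by rewrite rpredB // (subvP _ v Vv) // orthov_sym.
have: u \in (U :&: orthov form U)%VS by rewrite memv_cap Uu.
by rewrite capv_orthov_eq0 memv0 def_w => /eqP->; rewrite add0r.
Qed.

End OrthogonalComplement.

(** * The symplectic case: blocks, centralizer, dimension *)

Section Symplectic.
Variables (F : fieldType) (n : nat).
Hypothesis nz2 : 2%:R != 0 :> F.

Lemma trmx_Jmx : (Jmx F n)^T = - Jmx F n.
Proof. by rewrite tr_block_mx opp_block_mx !trmx0 raddfN /= trmx1 oppr0 opprK. Qed.

Lemma Jmx_unit : Jmx F n \in unitmx.
Proof.
suff /mulmx1_unit[] : Jmx F n *m - Jmx F n = 1%:M by [].
rewrite mulmxN mulmx_block !mul0mx !mulmx0 mulmxN mulNmx mulmx1 !addr0 !add0r.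
by rewrite opp_block_mx oppr0 opprK -scalar_mx_block.
Qed.

Lemma mem_sp_block A B C D :
  (block_mx A B C D \in sp F n) = [&& C^T == C, B^T == B & D == - A^T].
Proof.
rewrite mem_lieL tr_block_mx !mulmx_block opp_block_mx.
rewrite !mul0mx !mulmx0 !mulmxN !mulmx1 !mul1mx !addr0 !add0r !mulNmx !mul1mx !opprK.
apply/eqP/and3P => [/eq_block_mx[/oppr_inj-> -> _ ->]|[/eqP-> /eqP-> /eqP->]].
  by rewrite opprK.
by rewrite raddfN /= trmxK !opprK.
Qed.

Lemma mem_lieM_Jmx_block A B C D :
  (block_mx A B C D \in lieM (Jmx F n)) = [&& C^T == - C, B^T == - B & D == A^T].
Proof.
rewrite mem_lieM tr_block_mx !mulmx_block.
rewrite !mul0mx !mulmx0 !mulmxN !mulmx1 !mul1mx !addr0 !add0r !mulNmx !mul1mx.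
apply/eqP/and3P => [/eq_block_mx[CE -> _ ->]|[/eqP-> /eqP-> /eqP->]].
  by rewrite -[in X in _ == X]CE opprK.
by rewrite trmxK opprK.
Qed.

Lemma mem_lieM_Jmx Y : Y \in lieM (Jmx F n) <->
  exists A B C : 'M[F]_n, [/\ B^T = - B, C^T = - C & Y = block_mx A B C A^T].
Proof.
split=> [|[A [B [C [skewB skewC ->]]]]]; last first.
  by rewrite mem_lieM_Jmx_block skewB skewC !eqxx.
rewrite -[Y]submxK mem_lieM_Jmx_block => /and3P[/eqP skC /eqP skB /eqP->].
by exists (ulsubmx Y), (ursubmx Y), (dlsubmx Y).
Qed.

Lemma sp_centralizer_lieM X : (2 <= n)%N -> X \in sp F n ->
  {in lieM (Jmx F n), forall Y, bracket X Y = 0} -> X = 0.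
Proof.
move=> n_ge2; rewrite -[X]submxK.
move: (ulsubmx X) (ursubmx X) (dlsubmx X) (drsubmx X) => A B C D.
rewrite mem_sp_block => /and3P[_ _ /eqP-> {D}] comm_X.
have comm_diag Z : [/\ A *m Z = Z *m A, B *m Z^T = Z *m B & C *m Z = Z^T *m C].
  have /comm_X/eqP : block_mx Z 0 0 Z^T \in lieM (Jmx F n).
    by rewrite mem_lieM_Jmx_block trmx0 oppr0 !eqxx.
  rewrite subr_eq0 => /eqP; rewrite !mulmx_block !mul0mx !mulmx0 !addr0 !add0r.
  by case/eq_block_mx.
have B0 : B = 0 by apply: twisted_centralizer_eq0 => // Z; case: (comm_diag Z).
have C0 : C = 0.
  apply: twisted_centralizer_eq0 => // Z.
  (* Taking Z^T for Z puts the relation C Z = Z^T C in the form of the lemma. *)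
  by case: (comm_diag Z^T) => _ _; rewrite trmxK.
have /is_scalar_mxP[a def_A] : is_scalar_mx A.
  by apply: centralizer_is_scalar => Z; case: (comm_diag Z).
(* What is left is X = diag(a, -a); commuting with the upper right block K gives a K = - a K, hence
   a = 0. *)
have [K skewK nzK] := exists_skew_neq0 F n_ge2.
have /comm_X/eqP : block_mx 0 K 0 0 \in lieM (Jmx F n).
  by rewrite mem_lieM_Jmx_block !trmx0 skewK oppr0 !eqxx.
rewrite subr_eq0 => /eqP; rewrite !mulmx_block !mul0mx !mulmx0 !addr0 !add0r.
case/eq_block_mx=> _ AK _ _; move: AK.
rewrite def_A tr_scalar_mx mulmxN scalar_mxC => /(eq_opp_mx_eq0 nz2)/eqP.
rewrite mul_scalar_mx scaler_eq0 (negPf nzK) orbF => /eqP->.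
by rewrite B0 C0 raddf0 oppr0 block_mx0.
Qed.

Lemma mem_scalars_lieM a : a%:M \in lieM (Jmx F n).
Proof. by rewrite mem_lieM tr_scalar_mx scalar_mxC. Qed.

Lemma dim_sp : \dim (sp F n) = 'C((n + n).+1, 2).
Proof.
have := dimv_sum_cap (sp F n) (lieM (Jmx F n)).
rewrite (addv_lieL_lieM nz2 Jmx_unit trmx_Jmx) (capv_lieL_lieM nz2 Jmx_unit).
rewrite dimvf dim_matrix dimv0 addn0 (dim_lieM nz2 Jmx_unit trmx_Jmx).
rewrite -[((n + n) * (n + n))%R]/((n + n) * (n + n))%N.
(* Both binomials become polynomial relations in n, so that [nia] can solve (2n)^2 - 'C(2n, 2) =
   'C(2n + 1, 2). *)
have := mul_bin_diag (n + n) 1; have := mul_bin_diag (n + n).+1 1; rewrite !bin1 /=.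
by move: 'C(_, 2) 'C(_, 2) => k l; nia.
Qed.

(** * The traceless part of M and the scalars *)

Local Notation M0 := (lieM (Jmx F n) :&: sl F (n + n))%VS.
Local Notation S := (scalars F (n + n)).

Lemma submodule_traceless : submodule (sp F n) M0.
Proof.
move=> X Y LX /memv_capP[MY _]; rewrite memv_cap mem_sl mxtrace_bracket eqxx andbT.
exact: bracket_lieL_lieM.
Qed.

Lemma submodule_scalars : submodule (sp F n) S.
Proof.
move=> X Y _; rewrite [Y \in _]mem_scalars => /is_scalar_mxP[a ->].
by rewrite bracket_scalar mem0v.
Qed.

Lemma scalars_sub_lieM : (S <= lieM (Jmx F n))%VS.
Proof.
by apply/subvP => Y; rewrite mem_scalars => /is_scalar_mxP[a ->]; apply: mem_scalars_lieM.
Qed.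

Lemma traceless_orthov_scalars : (M0 <= orthov (trace_form F (n + n)) S)%VS.
Proof.
apply/orthovP => X Y; rewrite memv_cap mem_sl mem_scalars => /andP[_ /eqP trX].
by case/is_scalar_mxP=> a ->; rewrite /= /trform mul_mx_scalar mxtraceZ trX mulr0.
Qed.

Hypothesis nz2n : (n + n)%:R != 0 :> F.

Lemma addv_traceless_scalars : (M0 + S = lieM (Jmx F n))%VS.
Proof.
apply/eqP; rewrite eqEsubv subv_add capvSl scalars_sub_lieM; apply/subvP => Y MY.
(* The scalar matrix with the same trace as [Y]. *)
pose c := (\tr Y / (n + n)%:R)%:M : 'M[F]_(n + n).
rewrite -[Y](subrK c) memv_add //; last by rewrite mem_scalars scalar_mx_is_scalar.
rewrite memv_cap rpredB ?mem_scalars_lieM //= mem_sl raddfB /= mxtrace_scalar.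
by rewrite -[X in _ - X]mulr_natr divfK ?subrr.
Qed.

Lemma capv_traceless_scalars : (M0 :&: S = 0)%VS.
Proof.
apply/eqP; rewrite -subv0; apply/subvP => Y; rewrite !memv_cap mem_sl mem_scalars.
case/andP=> /andP[_ trY] /is_scalar_mxP[a def_Y]; move: trY; rewrite def_Y.
rewrite mxtrace_scalar -mulr_natr mulf_eq0 (negPf nz2n) orbF => /eqP->.
by rewrite raddf0 mem0v.
Qed.

Lemma dim_scalars : \dim S = 1%N.
Proof.
rewrite dim_vline; case: eqP => // /(congr1 mxtrace)/eqP.
by rewrite mxtrace0 mxtrace1 (negPf nz2n).
Qed.

Lemma dim_traceless : \dim M0 = (2 * n ^ 2 - n - 1)%N.
Proof.
have := dimv_disjoint_sum capv_traceless_scalars.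
rewrite addv_traceless_scalars (dim_lieM nz2 Jmx_unit trmx_Jmx) dim_scalars.
have := mul_bin_diag (n + n) 1; rewrite !bin1 /= => binE dimE; nia.
Qed.

(** A difference of two elements acting alike on M0 kills M0 and also the scalars, hence all of M,
    where [sp_centralizer_lieM] applies. *)
Lemma faithful_traceless : (2 <= n)%N -> faithful (sp F n) M0.
Proof.
move=> n_ge2 X Y LX LY eqXY; apply/eqP; rewrite -subr_eq0; apply/eqP.
apply: sp_centralizer_lieM => //; first exact: rpredB.
rewrite -addv_traceless_scalars => W /memv_addP[U MU [V]].
rewrite mem_scalars => /is_scalar_mxP[a ->] ->.
by rewrite linearD /= bracket_scalar addr0 bracketBl eqXY // subrr.
Qed.

Lemma orthov_sp : orthov (trace_form F (n + n)) (sp F n) = lieM (Jmx F n).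
Proof.
apply: orthov_complement; first exact: orthov_trace_form_fullv.
  exact: addv_lieL_lieM nz2 Jmx_unit trmx_Jmx.
exact: lieL_orthov_lieM nz2 Jmx_unit.
Qed.

Lemma sp_orthov_traceless : (sp F n <= orthov (trace_form F (n + n)) M0)%VS.
Proof. by rewrite orthov_sym orthov_sp capvSl. Qed.

Lemma sp_orthov_scalars : (sp F n <= orthov (trace_form F (n + n)) S)%VS.
Proof. by rewrite orthov_sym orthov_sp scalars_sub_lieM. Qed.

Lemma addv_sp_traceless_scalars : (sp F n + M0 + S = fullv)%VS.
Proof.
rewrite -addvA addv_traceless_scalars.
exact: addv_lieL_lieM nz2 Jmx_unit trmx_Jmx.
Qed.

Lemma directv_sp_traceless_scalars : directv (sp F n + M0 + S).
Proof.
apply/directvP; rewrite /= -addvA dimv_disjoint_sum.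
  by rewrite dimv_disjoint_sum ?capv_traceless_scalars // addnA.
by rewrite addv_traceless_scalars (capv_lieL_lieM nz2 Jmx_unit).
Qed.

(** M0 has the orthogonal complementary subspace sp + S, so [capv_orthov_eq0] applies. *)
Lemma nondegenerate_traceless : trace_form_nondegenerate M0.
Proof.
apply: (@capv_orthov_eq0 _ _ _ _ (sp F n + S)%VS).
- exact: orthov_trace_form_fullv.
- by rewrite addvA [(M0 + _)%VS]addvC addv_sp_traceless_scalars.
- by rewrite orthovD traceless_orthov_scalars orthov_sym sp_orthov_traceless.
Qed.

Lemma orthogonal_module_traceless : (forall a : F, exists c, a = c ^+ 2) ->
  (2 <= n)%N -> orthogonal_module (sp F n) M0 (2 * n ^ 2 - n - 1)%N.
Proof.
move=> squares n_ge2; split.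
- split; [exact: submodule_traceless | exact: faithful_traceless |].
  exact: dim_traceless.
- by move=> X U V _ _ _; apply: trace_form_bracket.
- exact: nondegenerate_traceless.
- exact: (@exists_orthonormal_basis _ _ (trace_form F (n + n)) nz2 _ _ squares nondegenerate_traceless dim_traceless).
Qed.

End Symplectic.

Theorem theorem3p1 (F : fieldType) (n : nat)
    (char_neq2 : 2%N \notin [pchar F])
    (n_gt0 : (0 < n)%N)
    (char_ndvd : forall l : nat, l \in [pchar F] -> ~~ (l %| 2 * n)%N) :
  let L := sp F n in
  let M := lieM (Jmx F n) in
  let M0 := (M :&: sl F (n + n))%VS in
  let S := scalars F (n + n) in
  let phi := trace_form F (n + n) in
  [/\ [/\ submodule L L, submodule L M0 & submodule L S] /\
      [/\ (L + M0 + S)%VS = fullv, directv (L + M0 + S),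
          (L <= orthov phi M0)%VS, (L <= orthov phi S)%VS
        & (M0 <= orthov phi S)%VS],
      M = orthov phi L,
      (forall Y : 'M[F]_(n + n), Y \in M <->
         exists A B C : 'M[F]_n,
           [/\ B^T = - B, C^T = - C & Y = block_mx A B C A^T]),
      \dim M0 = (2 * n ^ 2 - n - 1)%N /\ ((2 <= n)%N -> faithful L M0)
    & (forall a : F, exists c : F, a = c ^+ 2) -> (2 <= n)%N ->
      induces_embedding L M0 (2 * n ^ 2 - n - 1)%N /\
      (n = 2%N -> induces_isomorphism L M0 5%N)].
Proof.
have nz2 : 2%:R != 0 :> F by move: char_neq2; rewrite inE.
have nz2n : (n + n)%:R != 0 :> F.
  (* In a field, 2n is nonzero once it is positive and no prime divisor of it is the
     characteristic. *)
  rewrite addnn -mul2n natf_neq0_pchar; apply/pnatP => [|p _ p_dvd]; first by rewrite muln_gt0.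
  by rewrite inE; apply: contraL p_dvd => /char_ndvd.
move=> L M M0 S phi; split.
- split; split.
  + exact: lieL_subalgebra.
  + exact: submodule_traceless.
  + exact: submodule_scalars.
  + exact: addv_sp_traceless_scalars.
  + exact: directv_sp_traceless_scalars.
  + exact: sp_orthov_traceless.
  + exact: sp_orthov_scalars.
  + exact: traceless_orthov_scalars.
- by rewrite /phi orthov_sp.
- exact: mem_lieM_Jmx.
- by split; [apply: dim_traceless | apply: faithful_traceless].
move=> squares n_ge2; split; [split|].
- exact: orthogonal_module_traceless.
- move=> b /andP[basb onb]; apply: ad_mx_lie_embedding basb _ onb.
    exact: submodule_traceless.
  exact: faithful_traceless.
move=> n2; split.
  by have := orthogonal_module_traceless nz2 nz2n squares n_ge2; rewrite -/M0 [in X in _ X]n2.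
move=> b /andP[basb onb]; apply: ad_mx_lie_isomorphism basb _ onb _.
- exact: submodule_traceless.
- exact: faithful_traceless.
(* Both sides are 'C(5, 2): on the left 5 is 2n + 1, on the right the size of the skew matrices. *)
by rewrite dim_sp // dim_so // n2.
Qed.
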